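(* Let $G$ be a torsion-free Abelian group of rank $1$. Then $G\oplus G$ is perspective if and only if for all coprime integers $m,n\geq 1$ and all integers $k,t\geq 0$ such that (i) at least one of $k,t$ is non-zero, and (ii) if one of $k,t$ is zero then the other is equal to $1$, and (iii) if both $k,t$ are non-zero then they are coprime, in each of the following cases: 1) $mG\neq G$, $k=1$, $t=0$; 2) $nG\neq G$, $k=0$, $t=1$; 3) $mG\neq G$, $tG\neq G$, where $t\neq 0$; 4) $mG\neq G$ and $nG\neq G$; there exist coprime integers $s,l$ with $(ml-sn)G=G$ and $(kl-st)G=G$.
   Context: An Abelian group $G$ is called perspective if any two isomorphic direct summands of $G$ have a common direct complement: whenever $G=A\oplus H=B\oplus K$ with $A\cong B$, there exists a subgroup $C\le G$ with $G=A\oplus C=B\oplus C$. For an integer $x$, $xG=\{xg : g\in G\}$. *)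

(* Defs.v *)
From mathcomp Require Import all_boot all_order all_algebra.
From mathcomp Require Import mathcomp_extra boolp classical_sets functions.

Set Implicit Arguments.
Unset Strict Implicit.
Unset Printing Implicit Defensive.

Import Order.TTheory GRing.Theory Num.Theory.

Local Open Scope classical_set_scope.
Local Open Scope ring_scope.

Definition torsion_free (V : zmodType) : Prop :=
  forall (x : V) (n : nat), (0 < n)%N -> x *+ n = 0 -> x = 0.

Definition zindependent (V : zmodType) (r : nat) (x : 'I_r -> V) : Prop :=
  forall c : 'I_r -> int, \sum_(i < r) x i *~ c i = 0 -> forall i, c i = 0.

(* The torsion-free rank; on torsion-free groups it is the usual rank. *)
Definition has_rank (V : zmodType) (r : nat) : Prop :=
  (exists x : 'I_r -> V, zindependent x) /\
  (forall (n : nat) (x : 'I_n -> V), zindependent x -> (n <= r)%N).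

Definition multiples (V : zmodType) (n : int) : set V :=
  [set x *~ n | x in [set: V]].
Arguments multiples : clear implicits.

Definition internal_direct_sum (V : zmodType) (A B : set V) : Prop :=
  [/\ zmod_closed [in A], zmod_closed [in B],
      A `&` B = [set 0] & [set a + b | a in A & b in B] = [set: V]].

(* Only the restriction of f to A matters; its values off A are arbitrary. *)
Definition isomorphic_subgroups (V : zmodType) (A B : set V) : Prop :=
  exists f : V -> V, set_bij A B f /\ {in A &, {morph f : x y / x + y}}.

Definition perspective (V : zmodType) : Prop :=
  forall A H B K : set V,
    internal_direct_sum A H -> internal_direct_sum B K ->
    isomorphic_subgroups A B ->
    exists C : set V, internal_direct_sum A C /\ internal_direct_sum B C.

(* Main.v *)
Require Import Defs.
From mathcomp Require Import all_boot all_order all_algebra.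
From mathcomp Require Import mathcomp_extra boolp classical_sets functions.
From mathcomp Require Import ring.

(** Proper non-zero direct summands of G ⊕ G are exactly the lines
    {(mg, ng) : g in G} with m, n coprime.  Indeed G is locally cyclic, so a
    non-zero element of a summand A has the form (mg, ng) with m, n coprime;
    A is pure, and every element of the line through (m, n) is commensurable
    with this one, so A contains the whole line.  An element of A off that line
    gives in the same way a complementary line inside A, which forces
    A = G ⊕ G ([summand_square_cases]).

    All such lines are copies of G, and the line through (m, n) is complemented
    by the line through (s, l) exactly when the determinant ml - sn acts
    invertibly on G ([line_sum_of_det], [det_of_line_sum]).  Since 0 and
    G ⊕ G are isomorphic to no other summand, perspectivity of G ⊕ G
    means: for all coprime pairs (m, n) and (k, t) there is a coprime pair
    (s, l) such that both ml - sn and kl - st act invertibly.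

    This contains the stated arithmetic condition.  Conversely, the first case
    of that condition, (k, t) = (1, 0), already suffices: a unimodular
    change of coordinates moves any coprime pair (k, t) to (1, 0)
    ([unit_determinants_change_basis]), the signs of m and n can be absorbed into
    those of s and l, and when mG = G the pair (s, l) = (0, 1) works
    ([unit_determinant_of_pos]). *)

Set Implicit Arguments.
Unset Strict Implicit.
Unset Printing Implicit Defensive.

Import Order.TTheory GRing.Theory Num.Theory.

Local Open Scope classical_set_scope.
Local Open Scope ring_scope.

(** * Torsion-free groups and integer multiples *)

Lemma mulrz_eq0_torsion_free (G : zmodType) (c : int) (x : G) :
  torsion_free G -> c <> 0 -> x *~ c = 0 -> x = 0.
Proof.
move=> tfG; case: c => n n0 xn0.
  by apply: (tfG x n) => //; rewrite lt0n;
     apply/eqP => n_eq0; rewrite n_eq0 in n0.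
by apply: (tfG x n.+1) => //; apply: oppr_inj; rewrite oppr0.
Qed.

Lemma mulrz_can_torsion_free (G : zmodType) (c : int) (x y : G) :
  torsion_free G -> c <> 0 -> x *~ c = y *~ c -> x = y.
Proof.
move=> tfG c0 /eqP; rewrite -subr_eq0 -mulrzBl => /eqP.
by move/(mulrz_eq0_torsion_free tfG c0)/eqP; rewrite subr_eq0 => /eqP.
Qed.

Lemma pair_mulrz (U V : zmodType) (x : U) (y : V) (c : int) :
  (x, y) *~ c = (x *~ c, y *~ c).
Proof.
by rewrite [LHS]surjective_pairing; congr (_, _);
   [exact: (raddfMz fst)|exact: (raddfMz snd)].
Qed.

Lemma torsion_free_square (G : zmodType) :
  torsion_free G -> torsion_free (G * G)%type.
Proof.
move=> tfG [x y] n n0; rewrite pmulrn pair_mulrz => -[].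
by rewrite -!pmulrn => /(tfG _ _ n0) -> /(tfG _ _ n0) ->.
Qed.

(** * Groups of rank one *)

(** A form of rank at most one that makes sense for a subgroup given as a set,
    so that it can be carried along an isomorphism of subgroups. *)
Definition rank_le1 (V : zmodType) (A : set V) : Prop :=
  forall x y, A x -> A y ->
  exists c d : int, (c <> 0 \/ d <> 0) /\ x *~ c = y *~ d.

Lemma has_rank1_rank_le1 (G : zmodType) : has_rank G 1 -> rank_le1 [set: G].
Proof.
move=> [_ Gmax] x y _ _; apply: contrapT => indep.
pose e (i : 'I_2) := if i == 0 then x else y.
suff /Gmax : zindependent e by [].
move=> c; rewrite !big_ord_recl big_ord0 addr0 /e /= => /eqP.
rewrite addr_eq0 -mulrNz => /eqP rel i; apply: contrapT => ci0.
apply: indep; exists (c ord0), (- c (lift ord0 ord0)); split => //.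
case: (unliftP ord0 i) ci0 => [j ->|-> ci0]; last by left.
by rewrite (ord1 j) => ci0; right => /eqP; rewrite oppr_eq0 => /eqP.
Qed.

Lemma has_rank1_nontrivial (G : zmodType) :
  has_rank G 1 -> exists a : G, a <> 0.
Proof.
move=> [[x indep] _]; exists (x 0) => x0.
suff : (1 : int) = 0 by [].
by apply: (indep (fun=> 1) _ 0); rewrite big_ord1 x0 mul0rz.
Qed.

Definition locally_cyclic (G : zmodType) : Prop :=
  forall x y : G, exists (g : G) (m n : int),
    [/\ coprimez m n, x = g *~ m & y = g *~ n].

(** A relation xc = yd may be divided by gcd(c, d) because the group is
    torsion-free; with uc + vd = 1 the element vx + uy then generates a cyclic
    group containing x = d(vx + uy) and y = c(vx + uy). *)
Lemma rank_le1_locally_cyclic (G : zmodType) :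
  torsion_free G -> rank_le1 [set: G] -> locally_cyclic G.
Proof.
move=> tfG rG x y; have [c [d [cd0 rel]]] := rG x y I I.
have [u [v uv]] := Bezoutz c d.
have g0 : gcdz c d <> 0.
  by move/eqP; rewrite gcdz_eq0 => /andP[/eqP ? /eqP ?]; case: cd0.
have [c' Ec] : exists c', c = c' * gcdz c d by apply/dvdzP; exact: dvdz_gcdl.
have [d' Ed] : exists d', d = d' * gcdz c d by apply/dvdzP; exact: dvdz_gcdr.
have bez : u * c' + v * d' = 1.
  apply: (mulIf (x := gcdz c d)); first exact/eqP.
  by rewrite mul1r mulrDl -!mulrA -Ec -Ed.
have rel' : x *~ c' = y *~ d'.
  by apply: (mulrz_can_torsion_free tfG g0); rewrite -!mulrzA -Ec -Ed.
exists (x *~ v + y *~ u), d', c'; split.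
- by apply/coprimezP; exists (v, u) => /=; rewrite addrC.
- rewrite mulrzDl -!mulrzA [u * _]mulrC (mulrzA y) -rel' -mulrzA -mulrzDr.
  by rewrite [c' * u]mulrC addrC bez mulr1z.
- rewrite mulrzDl -!mulrzA [v * _]mulrC (mulrzA x) rel' -mulrzA -mulrzDr.
  by rewrite [d' * v]mulrC addrC bez mulr1z.
Qed.

Lemma morph_mulrz (V W : zmodType) (A : set V) (f : V -> W) :
  zmod_closed [in A] -> {in A &, {morph f : x y / x + y}} ->
  forall x (c : int), A x -> A (x *~ c) /\ f (x *~ c) = f x *~ c.
Proof.
move=> [A0 AB] fD x c Ax.
have f0 : f 0 = 0.
  by apply: (addrI (f 0)); rewrite -fD // !addr0.
have nat_case (n : nat) : A (x *+ n) /\ f (x *+ n) = f x *+ n.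
  elim: n => [|n [An fn]]; first by rewrite !mulr0n f0; move: A0; rewrite inE.
  have AxD : A (x - (0 - x *+ n)).
    by move: (AB x (0 - x *+ n)); rewrite !inE; apply => //;
       move: (AB 0 (x *+ n)); rewrite !inE; apply => //; move: A0; rewrite inE.
  rewrite !mulrS; split; first by rewrite sub0r opprK in AxD.
  by rewrite fD ?inE // fn.
case: c => n; first by rewrite -!pmulrn.
have [An fn] := nat_case n.+1.
have AN : A (- (x *+ n.+1)).
  by move: (AB 0 (x *+ n.+1)); rewrite !inE sub0r;
     apply => //; move: A0; rewrite inE.
rewrite !NegzE !mulrNz -!pmulrn; split => //.
by apply: (addrI (f (x *+ n.+1))); rewrite -fD ?inE // !subrr f0 fn subrr.
Qed.

(** Shows that no line is isomorphic to the whole square: rank_le1 holds for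
    lines but not for G ⊕ G. *)
Lemma isomorphic_rank_le1 (V : zmodType) (A B : set V) :
  zmod_closed [in A] -> isomorphic_subgroups A B ->
  rank_le1 A <-> rank_le1 B.
Proof.
move=> cA [f [[fAB finj fsurj] fD]]; have fZ := morph_mulrz cA fD.
split=> [rA y y' /fsurj[x Ax <-] /fsurj[x' Ax' <-]|rB x x' Ax Ax'].
  have [c [d [cd0 rel]]] := rA _ _ Ax Ax'.
  exists c, d; split=> //.
  by rewrite -(fZ x c Ax).2 -(fZ x' d Ax').2 rel.
have [c [d [cd0]]] := rB _ _ (fAB _ Ax) (fAB _ Ax').
rewrite -(fZ x c Ax).2 -(fZ x' d Ax').2 => rel.
exists c, d; split=> //.
by apply: finj => //; rewrite inE; [exact: (fZ x c Ax).1|exact: (fZ x' d Ax').1].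
Qed.

Lemma rank_le1_square (G : zmodType) :
  torsion_free G -> has_rank G 1 -> ~ rank_le1 [set: (G * G)%type].
Proof.
move=> tfG /has_rank1_nontrivial[a a0] /(_ (a, 0) (0, a) I I)[c [d [cd0]]].
rewrite !pair_mulrz !mul0rz => -[ac /esym ad].
by case: cd0 => [c0|d0]; apply: a0;
   [apply: mulrz_eq0_torsion_free c0 ac|apply: mulrz_eq0_torsion_free d0 ad].
Qed.

(** * Direct summands of the square *)

(** If z = a + h and zc lies in A, then hc = zc - ac lies in both A and H, hence
    vanishes, and so does h. *)
Lemma summand_pure (V : zmodType) (A H : set V) (c : int) (z : V) :
  torsion_free V -> internal_direct_sum A H -> c <> 0 -> A (z *~ c) -> A z.
Proof.
move=> tfV [[A0 AB] cH AH0 AHT] c0 Azc.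
have [a Aa [h Hh zE]] : [set a + b | a in A & b in H] z by rewrite AHT.
have idD (B : set V) : {in B &, {morph (@id V) : x y / x + y}} by [].
have [Aac _] := morph_mulrz (conj A0 AB) (@idD A) c Aa.
have [Hhc _] := morph_mulrz cH (@idD H) c Hh.
have hc0 : h *~ c = 0.
  have : (A `&` H) (h *~ c).
    split=> //; have -> : h *~ c = z *~ c - a *~ c.
      by rewrite -zE mulrzDl addrAC subrr add0r.
    by move: (AB (z *~ c) (a *~ c)); rewrite !inE; apply.
  by rewrite AH0.
by rewrite -zE (mulrz_eq0_torsion_free tfV c0 hc0) addr0.
Qed.

Definition line (G : zmodType) (m n : int) : set (G * G) :=
  [set z | exists g : G, z = (g *~ m, g *~ n)].
Arguments line : clear implicits.

Lemma line_closed (G : zmodType) (m n : int) : zmod_closed [in line G m n].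
Proof.
split; first by rewrite inE; exists 0; rewrite !mul0rz.
by move=> x y; rewrite !inE => -[g ->] [h ->]; exists (g - h); rewrite !mulrzBl.
Qed.

Lemma rank_le1_line (G : zmodType) (m n : int) :
  rank_le1 [set: G] -> rank_le1 (line G m n).
Proof.
move=> rG _ _ [g ->] [h ->]; have [c [d [cd0 rel]]] := rG g h I I.
exists c, d; split=> //; rewrite !pair_mulrz -!mulrzA.
by rewrite ![_ * c]mulrC ![_ * d]mulrC !mulrzA rel.
Qed.

Lemma line_coord (G : zmodType) (g : G) (m n u v : int) :
  u * m + v * n = 1 -> g *~ m *~ u + g *~ n *~ v = g.
Proof.
by move=> bez; rewrite -!mulrzA -mulrzDr [m * u]mulrC [n * v]mulrC bez mulr1z.
Qed.

(** When um + vn = 1, the map (x, y) |-> ux + vy recovers g from (mg, ng), so it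
    identifies each coprime line with G. *)
Lemma isomorphic_lines (G : zmodType) (m n k t : int) :
  coprimez m n -> coprimez k t ->
  isomorphic_subgroups (line G m n) (line G k t).
Proof.
move=> /coprimezP[[u v] /= uv] /coprimezP[[w x] /= wx].
pose r (z : G * G) := z.1 *~ u + z.2 *~ v.
have rE (g : G) : r (g *~ m, g *~ n) = g by exact: line_coord.
have rD y z : r (y + z) = r y + r z by rewrite /r /= !mulrzDl addrACA.
exists (fun z => (r z *~ k, r z *~ t)); split; first split.
- by move=> _ [g ->]; exists g; rewrite rE.
- move=> y z; rewrite !inE => -[g ->] [h ->]; rewrite !rE => -[gk gt].
  by rewrite -(line_coord g wx) gk gt (line_coord h wx).
- by move=> _ [g ->]; exists (g *~ m, g *~ n); rewrite ?rE //; exists g.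
- by move=> y z _ _ /=; rewrite rD !mulrzDl.
Qed.

(** Cramer's rule: solving mg + sh = x, ng + lh = y amounts to dividing
    lx - sy and my - nx by the determinant, which is possible because it acts
    surjectively; uniqueness holds because it is non-zero. *)
Lemma line_sum_of_det (G : zmodType) (m n s l : int) :
  torsion_free G -> (exists a : G, a <> 0) ->
  multiples G (m * l - s * n) = [set: G] ->
  internal_direct_sum (line G m n) (line G s l).
Proof.
move=> tfG [a a0] DG.
have D0 : m * l - s * n <> 0.
  move=> D0; have [b _ ba] : multiples G (m * l - s * n) a by rewrite DG.
  by apply: a0; rewrite -ba D0 mulr0z.
split; [exact: line_closed|exact: line_closed| |].
  apply/seteqP; split=> [_ [[g ->] [h [gm gn]]]|_ ->]; last first.
    by split; exists 0; rewrite !mul0rz.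
  have -> : g = 0.
    apply: mulrz_eq0_torsion_free D0 _ => //.
    rewrite mulrzBr [s * n]mulrC !mulrzA gm gn -!mulrzA [l * s]mulrC.
    exact: subrr.
  by rewrite !mul0rz.
apply/seteqP; split=> // -[x y] _.
have [g _ Eg] : multiples G (m * l - s * n) (x *~ l - y *~ s) by rewrite DG.
have [h _ Eh] : multiples G (m * l - s * n) (y *~ m - x *~ n) by rewrite DG.
exists (g *~ m, g *~ n); first by exists g.
exists (h *~ s, h *~ l); first by exists h.
congr (_, _); apply: (mulrz_can_torsion_free tfG D0); rewrite mulrzDl.
  rewrite ![_ *~ _ *~ (_ - _)]mulrzAC Eg Eh !mulrzBl -!mulrzA.
  by rewrite [s * m]mulrC addrA subrK -mulrzBr; congr (_ *~ _); ring.
rewrite ![_ *~ _ *~ (_ - _)]mulrzAC Eg Eh !mulrzBl -!mulrzA.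
by rewrite addrC [n * l]mulrC addrA subrK -mulrzBr.
Qed.

(** With um + vn = 1, the form (p, q) |-> mq - np kills the line through (m, n),
    sends (sh, lh) to (ml - sn)h, and takes the value x at (-vx, ux); decomposing
    the latter vector exhibits x as a multiple of the determinant. *)
Lemma det_of_line_sum (G : zmodType) (m n s l : int) :
  coprimez m n -> internal_direct_sum (line G m n) (line G s l) ->
  multiples G (m * l - s * n) = [set: G].
Proof.
move=> /coprimezP[[u v] /= uv] [_ _ _ sumT]; apply/seteqP; split=> // x _.
have [_ [g ->] [_ [h ->]] [Ex Ey]] :
    [set a + b | a in line G m n & b in line G s l] (- (x *~ v), x *~ u).
  by rewrite sumT.
exists h => //.
have -> : x = (x *~ u) *~ m - (- (x *~ v)) *~ n.
  by rewrite mulNrz opprK -!mulrzA -mulrzDr uv mulr1z.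
rewrite -Ex -Ey !mulrzDl opprD -!mulrzA [n * m]mulrC addrACA subrr add0r.
by rewrite -mulrzBr [l * m]mulrC.
Qed.

(** Any h satisfies ih = jg with i non-zero, so a non-zero multiple of the vector
    (mh, nh) is a multiple of (mg, ng); purity concludes. *)
Lemma line_sub_summand (G : zmodType) (A H : set (G * G)) (g : G) (m n : int) :
  torsion_free G -> locally_cyclic G -> internal_direct_sum A H ->
  g <> 0 -> A (g *~ m, g *~ n) -> line G m n `<=` A.
Proof.
move=> tfG lcG sumA g0 Ag _ [h ->].
have [e [i [j [_ gE hE]]]] := lcG g h.
have i0 : i <> 0 by move=> i0; apply: g0; rewrite gE i0 mulr0z.
apply: (summand_pure (c := i) (torsion_free_square tfG) sumA i0).
have [cA _ _ _] := sumA.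
have idD : {in A &, {morph (@id (G * G)%type) : x y / x + y}} by [].
have [+ _] := morph_mulrz cA idD j Ag.
rewrite !pair_mulrz hE gE -!mulrzA.
by congr (A (_ *~ _, _ *~ _)); ring.
Qed.

(** If a summand contains the line through (m, n) and one further vector, then
    subtracting the component of that vector along the line leaves a non-zero
    vector on the line through (v, -u), where um + vn = 1.  The two lines have
    determinant -1 and together span the square. *)
Lemma summand_square_cases (G : zmodType) (A H : set (G * G)) :
  torsion_free G -> locally_cyclic G -> internal_direct_sum A H ->
  [\/ A = [set 0], A = [set: (G * G)%type] |
      exists m n : int, coprimez m n /\ A = line G m n].
Proof.
move=> tfG lcG sumA; have [[A0 AB] _ _ _] := sumA.
have A00 : A 0 by move: A0; rewrite inE.
have Asub x y : A x -> A y -> A (x - y).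
  by move=> Ax Ay; move: (AB x y); rewrite !inE; apply.
have [[z [Az z0]]|noA] := pselect (exists z, A z /\ z <> 0); last first.
  apply: Or31; apply/seteqP; split=> [z Az|_ -> //].
  by apply: contrapT => z0; apply: noA; exists z.
case: z Az z0 => a b; have [g [m [n [mn -> ->]]]] := lcG a b => Ag gmn0.
have g0 : g <> 0 by move=> g0; apply: gmn0; rewrite g0 !mul0rz.
have lineA := line_sub_summand tfG lcG sumA g0 Ag.
have [Aline|] := pselect (A `<=` line G m n).
  by apply: Or33; exists m, n; split=> //; apply/seteqP.
move/existsNP=> [[x y] /not_implyP[Axy xyNline]]; apply: Or32.
have /coprimezP[[u v] /= uv] := mn.
pose e := x *~ n - y *~ m.
(* Coordinates in the unimodular basis (m, n), (v, -u). *)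
have split_mn (p q : G) : (p, q) =
    ((p *~ u + q *~ v) *~ m, (p *~ u + q *~ v) *~ n) +
    ((p *~ n - q *~ m) *~ v, (p *~ n - q *~ m) *~ - u).
  (* Writing p and q as multiples of one element turns the claim into an
     identity between integers. *)
  have [f [i [j [_ -> ->]]]] := lcG p q.
  congr (_, _); rewrite -!mulrzA -!(mulrzDr, mulrzBr) -!mulrzA -mulrzDr.
    by congr (_ *~ _); rewrite -[LHS]mulr1 -uv; ring.
  by congr (_ *~ _); rewrite -[LHS]mulr1 -uv; ring.
have e0 : e <> 0.
  move=> e0; apply: xyNline; exists (x *~ u + y *~ v).
  by rewrite [LHS]split_mn -/e e0 !mul0rz addr0.
have Ae : A (e *~ v, e *~ - u).
  have := Asub _ _ Axy (lineA _ (ex_intro _ (x *~ u + y *~ v) erefl)).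
  by rewrite [X in X - _]split_mn addrAC subrr add0r.
have lineA' := line_sub_summand tfG lcG sumA e0 Ae.
apply/seteqP; split=> // -[p q] _; rewrite [X in A X]split_mn -[X in _ + X]opprK.
apply: (Asub); first by apply: lineA; exists (p *~ u + q *~ v).
by rewrite -sub0r; apply: Asub => //; apply: lineA'; exists (p *~ n - q *~ m).
Qed.

Lemma internal_direct_sumC (V : zmodType) (A B : set V) :
  internal_direct_sum A B -> internal_direct_sum B A.
Proof.
move=> [cA cB AB0 ABT]; split=> //; first by rewrite setIC.
apply/seteqP; split=> // z _.
have [a Aa [b Bb <-]] : [set a + b | a in A & b in B] z by rewrite ABT.
by exists b => //; exists a => //; rewrite addrC.
Qed.

Lemma internal_direct_sum0T (V : zmodType) :
  internal_direct_sum [set 0] [set: V].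
Proof.
split.
- by split=> [|x y]; rewrite ?inE // => -> ->; rewrite subrr.
- by split=> [|x y]; rewrite ?inE.
- by rewrite setIT.
- by apply/seteqP; split=> // z _; exists 0 => //; exists z; rewrite ?add0r.
Qed.

Lemma isomorphic_trivial (V : zmodType) (A B : set V) :
  A 0 -> B 0 -> isomorphic_subgroups A B -> A = [set 0] <-> B = [set 0].
Proof.
move=> A0 B0 [f [[fAB finj fsurj] fD]]; split=> [AE|BE].
  apply/seteqP; split=> [y By|_ -> //].
  have [x Ax <-] := fsurj _ By; have [x' Ax' <-] := fsurj _ B0.
  by move: Ax Ax'; rewrite AE => -> ->.
apply/seteqP; split=> [x Ax|_ -> //]; apply: finj; rewrite ?inE //.
by move: (fAB _ Ax) (fAB _ A0); rewrite BE => -> ->.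
Qed.

(** * Unit determinants *)

Lemma multiplesN (V : zmodType) (c : int) : multiples V (- c) = multiples V c.
Proof.
by apply/seteqP; split=> _ [x _ <-]; exists (- x); rewrite ?mulNrz ?mulrNz ?opprK.
Qed.

Lemma multiples1 (V : zmodType) : multiples V 1 = [set: V].
Proof. by apply/seteqP; split=> // x _; exists x. Qed.

(** Flipping both m and n only changes the sign of the determinant, and flipping
    n alone is compensated by flipping s.  If mG = G then (s, l) = (0, 1) works;
    otherwise n = 0 is excluded, since it would give m = 1, and m = 0 forces
    n = 1, where (s, l) = (1, 1) works. *)
Lemma unit_determinant_of_pos (G : zmodType) :
  (forall m n : int, 1 <= m -> 1 <= n -> coprimez m n ->
     multiples G m <> [set: G] ->
     exists s l : int, multiples G (m * l - s * n) = [set: G] /\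
       multiples G l = [set: G]) ->
  forall m n : int, coprimez m n ->
    exists s l : int, multiples G (m * l - s * n) = [set: G] /\
       multiples G l = [set: G].
Proof.
move=> pos m n mn.
wlog m0 : m n mn / 0 <= m => [wlog_m|].
  have [|/ltW m0] := leP 0 m; first exact: wlog_m.
  have mnN : coprimez (- m) (- n) by rewrite coprimeNz coprimezN.
  have mN0 : 0 <= - m by rewrite oppr_ge0.
  have [s [l [ml ll]]] := wlog_m _ _ mnN mN0.
  exists s, l; split=> //; rewrite -ml -multiplesN; congr (multiples G _); ring.
wlog n0 : n mn / 0 <= n => [wlog_n|].
  have [|/ltW n0] := leP 0 n; first exact: wlog_n.
  have mnN : coprimez m (- n) by rewrite coprimezN.
  have nN0 : 0 <= - n by rewrite oppr_ge0.
  have [s [l [ml ll]]] := wlog_n _ mnN nN0.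
  exists (- s), l; split=> //; rewrite -ml; congr (multiples G _); ring.
have [mT|mT] := pselect (multiples G m = [set: G]).
  by exists 0, 1; rewrite mul0r subr0 mulr1 multiples1.
move: mn m0 n0; rewrite !le0r => mn /orP[/eqP mz|m0] /orP[/eqP nz|n0].
- by move: mn; rewrite mz nz.
- move: mn; rewrite mz /coprimez gcd0z => /eqP n1; exists 1, 1.
  have -> : n = 1 by rewrite -(gtr0_norm n0) -abszE n1.
  by rewrite mul0r mul1r sub0r multiplesN multiples1.
- move: mn; rewrite nz /coprimez gcdz0 => /eqP m1; case: mT.
  have -> : m = 1 by rewrite -(gtr0_norm m0) -abszE m1.
  exact: multiples1.
- by apply: pos mT => //; rewrite -gtz0_ge1.
Qed.

(** With ak + bt = 1, the unimodular map (x, y) |-> (ax + by, ky - tx) sends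
    (k, t) to (1, 0) and (m, n) to another coprime pair; determinants are
    preserved, so a solution for the image pairs pulls back. *)
Lemma unit_determinants_change_basis (G : zmodType) :
  (forall m n : int, coprimez m n ->
    exists s l : int, multiples G (m * l - s * n) = [set: G] /\
       multiples G l = [set: G]) ->
  forall m n k t : int, coprimez m n -> coprimez k t ->
    exists s l : int, multiples G (m * l - s * n) = [set: G] /\
       multiples G (k * l - s * t) = [set: G].
Proof.
move=> base m n k t /coprimezP[[u v] /= uv] /coprimezP[[a b] /= ab].
have [|s [l [ml ll]]] := base (a * m + b * n) (k * n - t * m).
  apply/coprimezP; exists (u * k + v * t, v * a - u * b) => /=.
  transitivity ((u * m + v * n) * (a * k + b * t)); first by ring.
  by rewrite uv ab mulr1.
exists (k * s - b * l), (t * s + a * l); split.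
  rewrite -ml; congr (multiples G _); ring.
have -> : k * (t * s + a * l) - (k * s - b * l) * t = (a * k + b * t) * l.
  by ring.
by rewrite ab mul1r.
Qed.

Theorem proposition3p27 (G : zmodType)
    (G_torsion_free : torsion_free G) (G_rank1 : has_rank G 1) :
  perspective (G * G)%type <->
  (forall m n k t : int,
     1 <= m -> 1 <= n -> coprimez m n ->
     0 <= k -> 0 <= t ->
     (k <> 0 \/ t <> 0) ->
     ((k = 0 -> t = 1) /\ (t = 0 -> k = 1)) ->
     (k <> 0 -> t <> 0 -> coprimez k t) ->
     [\/ [/\ multiples G m <> [set: G], k = 1 & t = 0],
         [/\ multiples G n <> [set: G], k = 0 & t = 1],
         [/\ multiples G m <> [set: G], multiples G t <> [set: G] & t <> 0] |
         (multiples G m <> [set: G] /\ multiples G n <> [set: G])] ->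
     exists s l : int,
       [/\ coprimez s l,
           multiples G (m * l - s * n) = [set: G] &
           multiples G (k * l - s * t) = [set: G]]).
Proof.
have rG := has_rank1_rank_le1 G_rank1.
have lcG := rank_le1_locally_cyclic G_torsion_free rG.
have Gnt := has_rank1_nontrivial G_rank1.
have rGG := rank_le1_square G_torsion_free G_rank1.
have line_neq0 m n : coprimez m n -> line G m n <> [set 0].
  move=> /coprimezP[[u v] /= uv] line0; have [a a0] := Gnt.
  have : line G m n (a *~ m, a *~ n) by exists a.
  rewrite line0 => -[am an]; apply: a0.
  by rewrite -(line_coord a uv) am an !mul0rz addr0.
have line_neqT m n : line G m n <> [set: (G * G)%type].
  by move=> lineT; apply: rGG; rewrite -lineT; exact: rank_le1_line.
have line_summand m n : coprimez m n ->
    exists H, internal_direct_sum (line G m n) H.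
  move=> /coprimezP[[u v] /= uv]; exists (line G (- v) u).
  apply: line_sum_of_det => //.
  by rewrite mulNr opprK [m * u]mulrC uv multiples1.
split=> [persp m n k t _ _ mn _ _ _ [k0 t0] kt _|cond].
  (* If one of k, t vanishes then the other is 1, so the pair is coprime. *)
  have {k0 t0}kt : coprimez k t.
    have [k_eq0|k_neq0] := eqVneq k 0; first by rewrite (k0 k_eq0) k_eq0.
    have [t_eq0|t_neq0] := eqVneq t 0; first by rewrite (t0 t_eq0) t_eq0.
    by apply: kt; apply/eqP.
  have [H sumH] := line_summand _ _ mn; have [K sumK] := line_summand _ _ kt.
  have [C [mnC ktC]] := persp _ _ _ _ sumH sumK (isomorphic_lines G mn kt).
  have := summand_square_cases G_torsion_free lcG (internal_direct_sumC mnC).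
  case=> [C0|CT|[s [l [sl CE]]]].
  - case: mnC => _ _ _; rewrite C0 => sumT; case: (line_neqT m n).
    apply/seteqP; split=> // z _.
    have [a la [_ -> <-]] :
      [set a + b | a in line G m n & b in [set 0]] z by rewrite sumT.
    by rewrite addr0.
  - by case: mnC; rewrite CT setIT => _ _ line0; case: (line_neq0 m n mn).
  - by exists s, l; split=> //; apply: det_of_line_sum => //; rewrite -CE.
(* The condition enters through (k, t) = (1, 0), where kl - st = l. *)
have det_exists : forall m n k t : int, coprimez m n -> coprimez k t ->
    exists s l : int, multiples G (m * l - s * n) = [set: G] /\
       multiples G (k * l - s * t) = [set: G].
  apply: unit_determinants_change_basis; apply: unit_determinant_of_pos.
  move=> m n m1 n1 mn mT.
  have [] := cond m n 1 0 m1 n1 mn => //; [by left|exact: Or41|].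
  by move=> s [l [_ ml]]; rewrite mulr0 subr0 mul1r => ll; exists s, l.
move=> A H B K sumA sumB AB.
have [[[A0 AA] _ _ _] [[B0 BB] _ _ _]] := (sumA, sumB).
have A00 : A 0 by move: A0; rewrite inE.
have B00 : B 0 by move: B0; rewrite inE.
have AB0 := isomorphic_trivial A00 B00 AB.
have ABr := isomorphic_rank_le1 (conj A0 AA) AB.
have sum0T := internal_direct_sum0T (G * G)%type.
have := summand_square_cases G_torsion_free lcG sumA.
have := summand_square_cases G_torsion_free lcG sumB.
have lineE C : (exists m n, coprimez m n /\ C = line G m n) ->
    C <> [set 0] /\ rank_le1 C.
  move=> [m [n [mn ->]]]; split; [exact: line_neq0|exact: rank_le1_line].
have trivial_case : A = [set 0] -> exists C, internal_direct_sum A C /\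
    internal_direct_sum B C.
  by move=> AE; exists [set: (G * G)%type]; rewrite (AB0.1 AE) AE.
case=> [BE|BE|Bline] [AE|AE|Aline].
- exact: trivial_case.
- exact/trivial_case/AB0.2.
- exact/trivial_case/AB0.2.
- exact: trivial_case.
- by exists [set 0]; rewrite AE BE; split; exact: internal_direct_sumC.
- by case: rGG; rewrite -BE; apply/ABr; case: (lineE _ Aline).
- exact: trivial_case.
- by case: rGG; rewrite -AE; apply/ABr; case: (lineE _ Bline).
have [m [n [mn ->]]] := Aline; have [k [t [kt ->]]] := Bline.
have [s [l [ml kl]]] := det_exists m n k t mn kt.
by exists (line G s l); split; exact: line_sum_of_det.
Qed.
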